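(* Let $M \in \mathcal{M}_{\mathfrak{sl}(1|1)}(2)$. Then either $$M \simeq M\left( \begin{bmatrix} 0 & 1 \\ 0 & 0 \end{bmatrix}, \begin{bmatrix} 0 & 0 \\ h & 0 \end{bmatrix} \right)\quad\text{or}\quad M \simeq M\left( \begin{bmatrix} 0 & h \\ 0 & 0 \end{bmatrix}, \begin{bmatrix} 0 & 0 \\ 1 & 0 \end{bmatrix} \right).$$ Moreover, $$M\left( \begin{bmatrix} 0 & 1 \\ 0 & 0 \end{bmatrix}, \begin{bmatrix} 0 & 0 \\ h & 0 \end{bmatrix} \right) \not\simeq M\left( \begin{bmatrix} 0 & h \\ 0 & 0 \end{bmatrix}, \begin{bmatrix} 0 & 0 \\ 1 & 0 \end{bmatrix} \right).$$
   Context: Everything is over $\mathbb{C}$. The Lie superalgebra $\mathfrak{sl}(1|1)$ has basis $x=e_{1\bar 1}$, $y=e_{\bar 1 1}$ (odd) and $h=e_{11}+e_{\bar 1\bar 1}$ (even); its Cartan subalgebra is $\mathfrak{h}=\mathbb{C}h$, and $\mathcal{U}(\mathfrak{h})=\mathbb{C}[h]$. In $\mathcal{U}(\mathfrak{sl}(1|1))$, viewed as an ungraded associative algebra, one has $x^2=y^2=0$, $xy+yx=h$, and $h$ is central. $\mathcal{M}_{\mathfrak{sl}(1|1)}(2)$ is the category of (not necessarily $\mathbb{Z}_2$-graded) $\mathcal{U}(\mathfrak{sl}(1|1))$-modules whose restriction to $\mathcal{U}(\mathfrak{h})$ is free of rank 2; $\simeq$ means isomorphism of $\mathcal{U}(\mathfrak{sl}(1|1))$-modules.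 For $P,Q\in \mathrm{Mat}_2(\mathbb{C}[h])$ with $P^2=Q^2=0$ and $PQ+QP=h I_2$, $M(P,Q)$ denotes $\mathbb{C}[h]^{\oplus 2}$ (column vectors) on which $h$ acts by multiplication, $x$ acts by left multiplication by $P$, and $y$ by left multiplication by $Q$. *)

(* Defs.v *)
From HB Require Import structures.
From mathcomp Require Import all_boot all_order all_algebra generic_quotient.
From mathcomp Require Import boolp reals complex.
From mathcomp Require Import ring.

Set Implicit Arguments.
Unset Strict Implicit.
Unset Printing Implicit Defensive.

Import GRing.Theory.
Local Open Scope ring_scope.
Local Open Scope quotient_scope.

Definition mx22 (R : Type) (a b c d : R) : 'M[R]_2 :=
  \matrix_(i, j) if i == 0 then (if j == 0 then a else b)
                 else (if j == 0 then c else d).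

Lemma mx22P (R : Type) (A B : 'M[R]_2) :
  A 0 0 = B 0 0 -> A 0 1 = B 0 1 -> A 1 0 = B 1 0 -> A 1 1 = B 1 1 -> A = B.
Proof.
have oE (k : 'I_2) : k = 0 \/ k = 1.
  by case: k => [[|[|//]] ?]; [left | right]; apply: val_inj.
move=> h00 h01 h10 h11; apply/matrixP => i j.
by case: (oE i) => ->; case: (oE j) => ->.
Qed.

Lemma mulmx2E (R : pzSemiRingType) n (A : 'M[R]_2) (B : 'M[R]_(2, n)) i j :
  (A *m B) i j = A i 0 * B 0 j + A i 1 * B 1 j.
Proof.
rewrite mxE !big_ord_recl big_ord0 addr0.
by rewrite (_ : lift ord0 ord0 = 1) //; apply: val_inj.
Qed.

(* The Lie superalgebra sl(1|1) over F (char F <> 2), inside the 2 x 2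
   matrices: index 0 stands for 1 and index 1 for \bar 1, so that the matrix
   unit e_ij has parity (i != j). *)
Section LieSuperalgebra.
Variable F : fieldType.

Definition supertrace (a : 'M[F]_2) : F := a 0 0 - a 1 1.

Definition sl11_pred : {pred 'M[F]_2} := fun a => supertrace a == 0.

Lemma sl11_submod_closed : submod_closed sl11_pred.
Proof.
split; first by rewrite unfold_in /supertrace !mxE subrr.
move=> k a b; rewrite !unfold_in /supertrace !mxE => /eqP ha /eqP hb.
by rewrite opprD addrACA hb addr0 -mulrBr ha mulr0.
Qed.

HB.instance Definition _ :=
  GRing.isSubmodClosed.Build F 'M[F]_2 sl11_pred sl11_submod_closed.

Record sl11 : predArgType :=
  Sl11 {sl11_val : 'M[F]_2; sl11_valP : sl11_val \in sl11_pred}.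

HB.instance Definition _ := [isSub for sl11_val].
HB.instance Definition _ := [Choice of sl11 by <:].
HB.instance Definition _ := [SubChoice_isSubLmodule of sl11 by <:].

Definition homogeneous (p : bool) (a : sl11) : Prop :=
  forall i j : 'I_2, (i != j) != p -> val a i j = 0.

Definition parity_part (p : bool) (a : 'M[F]_2) : 'M[F]_2 :=
  \matrix_(i, j) if (i != j) == p then a i j else 0.

(* [a, b] = ab - (-1)^{|a||b|} ba on homogeneous elements, extended
   bilinearly. *)
Definition mx_superbracket (a b : 'M[F]_2) : 'M[F]_2 :=
  \sum_(p : bool) \sum_(q : bool)
     (parity_part p a *m parity_part q b
      - (-1) ^+ (p && q) *: (parity_part q b *m parity_part p a)).

Lemma mx_superbracketE (a b : 'M[F]_2) :
  let c := a 0 1 * b 1 0 + a 1 0 * b 0 1 in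
  mx_superbracket a b = mx22 c ((a 0 0 - a 1 1) * b 0 1 - a 0 1 * (b 0 0 - b 1 1))
                             (a 1 0 * (b 0 0 - b 1 1) - (a 0 0 - a 1 1) * b 1 0) c.
Proof.
rewrite /mx_superbracket !big_bool /= expr0 expr1.
by apply: mx22P; rewrite !(mulmx2E, mxE) /=; ring.
Qed.

Lemma mx_superbracket_sl (a b : 'M[F]_2) : mx_superbracket a b \in sl11_pred.
Proof.
by rewrite mx_superbracketE unfold_in /supertrace !mxE subrr.
Qed.

Definition superbracket (a b : sl11) : sl11 :=
  Sl11 (mx_superbracket_sl (val a) (val b)).

Lemma sl_x_subproof : mx22 0 1 0 0 \in sl11_pred.
Proof. by rewrite unfold_in /supertrace !mxE subrr. Qed.
Definition sl_x : sl11 := Sl11 sl_x_subproof.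

Lemma sl_y_subproof : mx22 0 0 1 0 \in sl11_pred.
Proof. by rewrite unfold_in /supertrace !mxE subrr. Qed.
Definition sl_y : sl11 := Sl11 sl_y_subproof.

Lemma sl_h_subproof : mx22 1 0 0 1 \in sl11_pred.
Proof. by rewrite unfold_in /supertrace !mxE subrr. Qed.
Definition sl_h : sl11 := Sl11 sl_h_subproof.

End LieSuperalgebra.

(* U(sl(1|1)) as an ungraded associative unital algebra: the terms below modulo
   Uterm_eq, i.e. the free algebra on the vector space sl(1|1) modulo
   [a, b] = ab - (-1)^{|a||b|} ba for homogeneous a and b. *)
Section EnvelopingAlgebra.
Variable F : fieldType.

Inductive Uterm : Type :=
| Ugen_t of sl11 F
| Uzero_t
| Uone_t
| Uopp_t of Uterm
| Uadd_t of Uterm & Uterm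
| Umul_t of Uterm & Uterm
| Uscale_t of F & Uterm.

Inductive Uterm_eq : Uterm -> Uterm -> Prop :=
| Ueq_refl t : Uterm_eq t t
| Ueq_sym t u : Uterm_eq t u -> Uterm_eq u t
| Ueq_trans u t v : Uterm_eq t u -> Uterm_eq u v -> Uterm_eq t v
| Ueq_opp t t' : Uterm_eq t t' -> Uterm_eq (Uopp_t t) (Uopp_t t')
| Ueq_add t t' u u' : Uterm_eq t t' -> Uterm_eq u u' ->
    Uterm_eq (Uadd_t t u) (Uadd_t t' u')
| Ueq_mul t t' u u' : Uterm_eq t t' -> Uterm_eq u u' ->
    Uterm_eq (Umul_t t u) (Umul_t t' u')
| Ueq_scale k t t' : Uterm_eq t t' -> Uterm_eq (Uscale_t k t) (Uscale_t k t')
| Ueq_addA t u v :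
    Uterm_eq (Uadd_t t (Uadd_t u v)) (Uadd_t (Uadd_t t u) v)
| Ueq_addC t u : Uterm_eq (Uadd_t t u) (Uadd_t u t)
| Ueq_add0 t : Uterm_eq (Uadd_t Uzero_t t) t
| Ueq_addN t : Uterm_eq (Uadd_t (Uopp_t t) t) Uzero_t
| Ueq_mulA t u v :
    Uterm_eq (Umul_t t (Umul_t u v)) (Umul_t (Umul_t t u) v)
| Ueq_mul1l t : Uterm_eq (Umul_t Uone_t t) t
| Ueq_mul1r t : Uterm_eq (Umul_t t Uone_t) t
| Ueq_mulDl t u v :
    Uterm_eq (Umul_t (Uadd_t t u) v) (Uadd_t (Umul_t t v) (Umul_t u v))
| Ueq_mulDr t u v :
    Uterm_eq (Umul_t t (Uadd_t u v)) (Uadd_t (Umul_t t u) (Umul_t t v))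
| Ueq_scaleA k l t :
    Uterm_eq (Uscale_t k (Uscale_t l t)) (Uscale_t (k * l) t)
| Ueq_scale1 t : Uterm_eq (Uscale_t 1 t) t
| Ueq_scaleDr k t u :
    Uterm_eq (Uscale_t k (Uadd_t t u)) (Uadd_t (Uscale_t k t) (Uscale_t k u))
| Ueq_scaleDl k l t :
    Uterm_eq (Uscale_t (k + l) t) (Uadd_t (Uscale_t k t) (Uscale_t l t))
| Ueq_scaleAl k t u :
    Uterm_eq (Uscale_t k (Umul_t t u)) (Umul_t (Uscale_t k t) u)
| Ueq_scaleAr k t u :
    Uterm_eq (Uscale_t k (Umul_t t u)) (Umul_t t (Uscale_t k u))
| Ueq_gen_linear k a b :
    Uterm_eq (Ugen_t (k *: a + b)) (Uadd_t (Uscale_t k (Ugen_t a)) (Ugen_t b))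
| Ueq_gen_bracket p q a b : homogeneous p a -> homogeneous q b ->
    Uterm_eq (Ugen_t (superbracket a b))
      (Uadd_t (Umul_t (Ugen_t a) (Ugen_t b))
         (Uopp_t (Uscale_t ((-1) ^+ (p && q)) (Umul_t (Ugen_t b) (Ugen_t a))))).

HB.instance Definition _ := gen_eqMixin Uterm.
HB.instance Definition _ := gen_choiceMixin Uterm.

Definition Uterm_eqb : rel Uterm := fun t u => `[< Uterm_eq t u >].

Lemma Uterm_eqb_refl : reflexive Uterm_eqb.
Proof. by move=> t; apply/asboolP; exact: Ueq_refl. Qed.
Lemma Uterm_eqb_sym : symmetric Uterm_eqb.
Proof. by move=> t u; apply/asboolP/asboolP; exact: Ueq_sym. Qed.
Lemma Uterm_eqb_trans : transitive Uterm_eqb.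
Proof.
by move=> u t v /asboolP tu /asboolP uv; apply/asboolP; exact: Ueq_trans tu uv.
Qed.

Canonical Uterm_equiv :=
  EquivRel Uterm_eqb Uterm_eqb_refl Uterm_eqb_sym Uterm_eqb_trans.

Definition Usl11 : Type := {eq_quot Uterm_equiv}.
HB.instance Definition _ := Choice.on Usl11.
HB.instance Definition _ := EqQuotient.on Usl11.

Lemma Usl11_eqP t u : \pi_Usl11 t = \pi_Usl11 u <-> Uterm_eq t u.
Proof. by split=> [/eqmodP/asboolP//|tu]; apply/eqmodP/asboolP. Qed.

Lemma repr_pi t : Uterm_eq (repr (\pi_Usl11 t)) t.
Proof. by apply/Usl11_eqP; rewrite reprK. Qed.

Definition Uzero : Usl11 := \pi_Usl11 Uzero_t.
Definition Uone : Usl11 := \pi_Usl11 Uone_t.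
Definition Uopp (a : Usl11) : Usl11 := \pi_Usl11 (Uopp_t (repr a)).
Definition Uadd (a b : Usl11) : Usl11 := \pi_Usl11 (Uadd_t (repr a) (repr b)).
Definition Umul (a b : Usl11) : Usl11 := \pi_Usl11 (Umul_t (repr a) (repr b)).
Definition Uscale (k : F) (a : Usl11) : Usl11 := \pi_Usl11 (Uscale_t k (repr a)).

Lemma pi_Uopp t : Uopp (\pi_Usl11 t) = \pi_Usl11 (Uopp_t t).
Proof. by apply/Usl11_eqP; apply: Ueq_opp; apply: repr_pi. Qed.
Lemma pi_Uadd t u : Uadd (\pi_Usl11 t) (\pi_Usl11 u) = \pi_Usl11 (Uadd_t t u).
Proof. by apply/Usl11_eqP; apply: Ueq_add; apply: repr_pi. Qed.
Lemma pi_Umul t u : Umul (\pi_Usl11 t) (\pi_Usl11 u) = \pi_Usl11 (Umul_t t u).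
Proof. by apply/Usl11_eqP; apply: Ueq_mul; apply: repr_pi. Qed.
Lemma pi_Uscale k t : Uscale k (\pi_Usl11 t) = \pi_Usl11 (Uscale_t k t).
Proof. by apply/Usl11_eqP; apply: Ueq_scale; apply: repr_pi. Qed.

Lemma UaddA : associative Uadd.
Proof.
elim/quotW=> t; elim/quotW=> u; elim/quotW=> v.
rewrite (pi_Uadd u v) (pi_Uadd t) (pi_Uadd t u) (pi_Uadd _ v).
exact/Usl11_eqP/Ueq_addA.
Qed.
Lemma UaddC : commutative Uadd.
Proof.
elim/quotW=> t; elim/quotW=> u; rewrite (pi_Uadd t u) (pi_Uadd u t).
exact/Usl11_eqP/Ueq_addC.
Qed.
Lemma Uadd0 : left_id Uzero Uadd.
Proof.
by elim/quotW=> t; rewrite (pi_Uadd Uzero_t t); exact/Usl11_eqP/Ueq_add0.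
Qed.
Lemma UaddN : left_inverse Uzero Uopp Uadd.
Proof.
elim/quotW=> t; rewrite (pi_Uopp t) (pi_Uadd _ t).
exact/Usl11_eqP/Ueq_addN.
Qed.

HB.instance Definition _ := GRing.isZmodule.Build Usl11 UaddA UaddC Uadd0 UaddN.

Lemma UmulA : associative Umul.
Proof.
elim/quotW=> t; elim/quotW=> u; elim/quotW=> v.
rewrite (pi_Umul u v) (pi_Umul t) (pi_Umul t u) (pi_Umul _ v).
exact/Usl11_eqP/Ueq_mulA.
Qed.
Lemma Umul1l : left_id Uone Umul.
Proof.
by elim/quotW=> t; rewrite (pi_Umul Uone_t t); exact/Usl11_eqP/Ueq_mul1l.
Qed.
Lemma Umul1r : right_id Uone Umul.
Proof.
by elim/quotW=> t; rewrite (pi_Umul t Uone_t); exact/Usl11_eqP/Ueq_mul1r.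
Qed.
Lemma UmulDl : left_distributive Umul Uadd.
Proof.
elim/quotW=> t; elim/quotW=> u; elim/quotW=> v.
rewrite (pi_Uadd t u) (pi_Umul _ v) (pi_Umul t v) (pi_Umul u v) (pi_Uadd _ (Umul_t u v)).
exact/Usl11_eqP/Ueq_mulDl.
Qed.
Lemma UmulDr : right_distributive Umul Uadd.
Proof.
elim/quotW=> t; elim/quotW=> u; elim/quotW=> v.
rewrite (pi_Uadd u v) (pi_Umul t) (pi_Umul t u) (pi_Umul t v) (pi_Uadd _ (Umul_t t v)).
exact/Usl11_eqP/Ueq_mulDr.
Qed.

(* M(P, Q) is defined from the ring morphism Uterm_eval, which is also what
   shows that U(sl(1|1)) is non-trivial. *)
Definition MPQ_rel (P Q : 'M[{poly F}]_2) : Prop :=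
  [/\ P *m P = 0, Q *m Q = 0 & P *m Q + Q *m P = 'X%:M].

Section Eval.
Variables P Q : 'M[{poly F}]_2.

(* a = a01 x + a10 y + a00 h for a in sl(1|1) *)
Definition gen_eval (a : sl11 F) : 'M[{poly F}]_2 :=
  (val a 0 1)%:P *: P + (val a 1 0)%:P *: Q + (val a 0 0)%:P *: 'X%:M.

Fixpoint Uterm_eval (t : Uterm) : 'M[{poly F}]_2 :=
  match t with
  | Ugen_t a => gen_eval a
  | Uzero_t => 0
  | Uone_t => 1%:M
  | Uopp_t t => - Uterm_eval t
  | Uadd_t t u => Uterm_eval t + Uterm_eval u
  | Umul_t t u => Uterm_eval t *m Uterm_eval u
  | Uscale_t k t => k%:P *: Uterm_eval t
  end.

Hypothesis PQ : MPQ_rel P Q.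

Lemma Uterm_eval_eq t u : Uterm_eq t u -> Uterm_eval t = Uterm_eval u.
Proof.
case: PQ => PP QQ PQQP.
elim=> //= {t u}.
- by move=> t u v _ -> _ ->.
- by move=> t t' _ ->.
- by move=> t t' u u' _ -> _ ->.
- by move=> t t' u u' _ -> _ ->.
- by move=> k t t' _ ->.
- by move=> *; rewrite addrA.
- by move=> *; rewrite addrC.
- by move=> *; rewrite add0r.
- by move=> *; rewrite addNr.
- by move=> *; rewrite mulmxA.
- by move=> *; rewrite mul1mx.
- by move=> *; rewrite mulmx1.
- by move=> *; rewrite mulmxDl.
- by move=> *; rewrite mulmxDr.
- by move=> *; rewrite scalerA polyCM.
- by move=> *; rewrite scale1r.
- by move=> *; rewrite scalerDr.
- by move=> *; rewrite polyCD scalerDl.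
- by move=> *; rewrite scalemxAl.
- by move=> *; rewrite scalemxAr.
- move=> k a b; rewrite /gen_eval !mxE !polyCD !polyCM.
  by apply/matrixP => i j; rewrite !(mxE, mulrDl) -!mulrA !mulrDr; ring.
- move=> p q a b ha hb; rewrite /gen_eval /= mx_superbracketE !mxE /=.
  have -> : val a 1 1 = val a 0 0.
    by apply/esym/eqP; rewrite -subr_eq0; exact: (valP a).
  have -> : val b 1 1 = val b 0 0.
    by apply/esym/eqP; rewrite -subr_eq0; exact: (valP b).
  have : if p then val a 0 0 = 0 else val a 0 1 = 0 /\ val a 1 0 = 0.
    by case: p ha => ha; [exact: ha | split; exact: ha].
  have : if q then val b 0 0 = 0 else val b 0 1 = 0 /\ val b 1 0 = 0.
    by case: q hb => hb; [exact: hb | split; exact: hb].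
  rewrite /=; move: (sl11_val a 0 1) (sl11_val a 1 0) (sl11_val a 0 0).
  move: (sl11_val b 0 1) (sl11_val b 1 0) (sl11_val b 0 0) => {ha hb a b}.
  move=> b01 b10 b00 a01 a10 a00.
  rewrite !subrr !(mul0r, mulr0, subr0, polyC0, scale0r, add0r).
  case: p q => [] [] /= => [-> ->|[-> ->] ->|-> [-> ->]|[-> ->] [-> ->]];
    rewrite !(mul0r, mulr0, polyC0, scale0r, add0r, addr0) ?expr0 ?expr1.
  - rewrite oppr0 !polyC0 !scale0r !add0r polyCN scaleNr opprK scale1r -PQQP.
    rewrite !(mulmxDl, mulmxDr) -!scalemxAl -!scalemxAr PP QQ !scaler0.
    rewrite !(add0r, addr0) !scalerA polyCD !polyCM scalerDr !scalerDl.
    move: (P *m Q) (Q *m P) => S T.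
    by apply/matrixP => i j; rewrite !mxE; ring.
  all: rewrite oppr0 polyC0 !scale0r addr0 scale1r !scale_scalar_mx.
  all: by rewrite scalar_mxC subrr.
Qed.
End Eval.

Lemma MPQ_rel_1h : MPQ_rel (mx22 0 1 0 0) (mx22 0 0 'X 0).
Proof. by split; apply: mx22P; rewrite !(mulmx2E, mxE) /=; ring. Qed.

Lemma MPQ_rel_h1 : MPQ_rel (mx22 0 'X 0 0) (mx22 0 0 1 0).
Proof. by split; apply: mx22P; rewrite !(mulmx2E, mxE) /=; ring. Qed.

Lemma Uone_neq0 : Uone != Uzero.
Proof.
apply/eqP => /Usl11_eqP /(Uterm_eval_eq MPQ_rel_1h) /= /matrixP /(_ 0 0).
by rewrite !mxE /= => /eqP; rewrite oner_eq0.
Qed.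

HB.instance Definition _ := GRing.Zmodule_isNzRing.Build Usl11
  UmulA Umul1l Umul1r UmulDl UmulDr Uone_neq0.

Lemma UscaleA k l a : Uscale k (Uscale l a) = Uscale (k * l) a.
Proof.
elim/quotW: a => t; rewrite (pi_Uscale l) (pi_Uscale k) (pi_Uscale (k * l)).
exact/Usl11_eqP/Ueq_scaleA.
Qed.
Lemma Uscale1 : left_id 1 Uscale.
Proof.
by elim/quotW=> t; rewrite (pi_Uscale 1); exact/Usl11_eqP/Ueq_scale1.
Qed.
Lemma UscaleDr : right_distributive Uscale Uadd.
Proof.
move=> k; elim/quotW=> t; elim/quotW=> u.
rewrite (pi_Uadd t u) (pi_Uscale k t) (pi_Uscale k u) (pi_Uscale k (Uadd_t t u)).
rewrite (pi_Uadd (Uscale_t k t)); exact/Usl11_eqP/Ueq_scaleDr.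
Qed.
Lemma UscaleDl a k l : Uscale (k + l) a = Uadd (Uscale k a) (Uscale l a).
Proof.
elim/quotW: a => t.
rewrite (pi_Uscale k t) (pi_Uscale l t) (pi_Uscale (k + l) t).
rewrite (pi_Uadd (Uscale_t k t)); exact/Usl11_eqP/Ueq_scaleDl.
Qed.

HB.instance Definition _ := GRing.Zmodule_isLmodule.Build F Usl11
  UscaleA Uscale1 UscaleDr UscaleDl.

Lemma UscaleAl k a b : Uscale k (Umul a b) = Umul (Uscale k a) b.
Proof.
elim/quotW: a => t; elim/quotW: b => u.
rewrite (pi_Umul t u) (pi_Uscale k t) (pi_Uscale k (Umul_t t u)).
rewrite (pi_Umul (Uscale_t k t) u); exact/Usl11_eqP/Ueq_scaleAl.
Qed.

HB.instance Definition _ := GRing.Lmodule_isLalgebra.Build F Usl11 UscaleAl.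

Lemma UscaleAr k a b : Uscale k (Umul a b) = Umul a (Uscale k b).
Proof.
elim/quotW: a => t; elim/quotW: b => u.
rewrite (pi_Umul t u) (pi_Uscale k u) (pi_Uscale k (Umul_t t u)).
rewrite (pi_Umul t (Uscale_t k u)); exact/Usl11_eqP/Ueq_scaleAr.
Qed.

HB.instance Definition _ := GRing.Lalgebra_isAlgebra.Build F Usl11 UscaleAr.

Definition Ugen (a : sl11 F) : Usl11 := \pi_Usl11 (Ugen_t a).

Lemma Ugen_linear k (a b : sl11 F) : Ugen (k *: a + b) = k *: Ugen a + Ugen b.
Proof.
transitivity (Uadd (Uscale k (Ugen a)) (Ugen b)); last by [].
rewrite (pi_Uscale k (Ugen_t a)) (pi_Uadd _ (Ugen_t b)).
exact/Usl11_eqP/Ueq_gen_linear.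
Qed.

Lemma Ugen_bracket p q (a b : sl11 F) : homogeneous p a -> homogeneous q b ->
  Ugen (superbracket a b) =
  Ugen a * Ugen b - (-1) ^+ (p && q) *: (Ugen b * Ugen a).
Proof.
move=> ha hb; set s := (-1) ^+ _.
transitivity (Uadd (Umul (Ugen a) (Ugen b))
  (Uopp (Uscale s (Umul (Ugen b) (Ugen a))))); last by [].
rewrite (pi_Umul (Ugen_t a) (Ugen_t b)) (pi_Umul (Ugen_t b) (Ugen_t a)).
rewrite (pi_Uscale s (Umul_t _ _)) (pi_Uopp (Uscale_t s _)).
rewrite (pi_Uadd (Umul_t _ _) (Uopp_t _)).
exact/Usl11_eqP/Ueq_gen_bracket.
Qed.

Definition Ux : Usl11 := Ugen (sl_x F).
Definition Uy : Usl11 := Ugen (sl_y F).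
Definition Uh : Usl11 := Ugen (sl_h F).

Section Module.
Variables (P Q : 'M[{poly F}]_2) (PQ : MPQ_rel P Q).

(* M(P, Q), on column vectors over F[h], with h written 'X. *)
Definition MPQ of MPQ_rel P Q : Type := 'cV[{poly F}]_2.

HB.instance Definition _ := GRing.Zmodule.on (MPQ PQ).

Definition MPQ_act (a : Usl11) (v : MPQ PQ) : MPQ PQ :=
  Uterm_eval P Q (repr a) *m v.

Lemma MPQ_act_pi t (v : MPQ PQ) : MPQ_act (\pi_Usl11 t) v = Uterm_eval P Q t *m v.
Proof. by rewrite /MPQ_act (Uterm_eval_eq PQ (repr_pi t)). Qed.

Lemma MPQ_actA a b v : MPQ_act a (MPQ_act b v) = MPQ_act (a * b) v.
Proof. by rewrite [MPQ_act (_ * _) _]MPQ_act_pi /= -mulmxA. Qed.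
Lemma MPQ_act1 : left_id 1 MPQ_act.
Proof. by move=> v; rewrite [LHS](MPQ_act_pi Uone_t) mul1mx. Qed.
Lemma MPQ_actDr : right_distributive MPQ_act +%R.
Proof. by move=> a u v; rewrite /MPQ_act mulmxDr. Qed.
Lemma MPQ_actDl v : {morph MPQ_act^~ v : a b / a + b}.
Proof. by move=> a b; rewrite [LHS]MPQ_act_pi /= mulmxDl. Qed.

HB.instance Definition _ := GRing.Zmodule_isLmodule.Build Usl11 (MPQ PQ)
  MPQ_actA MPQ_act1 MPQ_actDr MPQ_actDl.

Lemma MPQ_gen a (v : MPQ PQ) : Ugen a *: v = gen_eval P Q a *m v.
Proof. exact: (MPQ_act_pi (Ugen_t a)). Qed.

Lemma MPQ_x (v : MPQ PQ) : Ux *: v = P *m v.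
Proof.
by rewrite MPQ_gen /gen_eval !mxE /= !polyC0 !scale0r !addr0 scale1r.
Qed.
Lemma MPQ_y (v : MPQ PQ) : Uy *: v = Q *m v.
Proof.
by rewrite MPQ_gen /gen_eval !mxE /= !polyC0 !scale0r addr0 add0r scale1r.
Qed.
Lemma MPQ_h (v : MPQ PQ) : Uh *: v = 'X *: (v : 'cV[{poly F}]_2).
Proof.
rewrite MPQ_gen /gen_eval !mxE /= !polyC0 !scale0r !add0r scale1r.
exact: mul_scalar_mx.
Qed.
End Module.

(* Restriction to U(h) = F[h]: p acts on M as p(h). *)
Definition res_h (M : lmodType Usl11) : Type := M.

Section Restriction.
Variable M : lmodType Usl11.

HB.instance Definition _ := GRing.Zmodule.on (res_h M).

Definition res_h_act (p : {poly F}) (v : res_h M) : res_h M :=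
  (horner_alg Uh p *: (v : M))%R.

Lemma res_h_actA p q v : res_h_act p (res_h_act q v) = res_h_act (p * q) v.
Proof. by rewrite /res_h_act rmorphM scalerA. Qed.
Lemma res_h_act1 : left_id 1 res_h_act.
Proof. by move=> v; rewrite /res_h_act rmorph1 scale1r. Qed.
Lemma res_h_actDr : right_distributive res_h_act +%R.
Proof. by move=> p u v; rewrite /res_h_act scalerDr. Qed.
Lemma res_h_actDl v : {morph res_h_act^~ v : p q / p + q}.
Proof. by move=> p q; rewrite /res_h_act rmorphD scalerDl. Qed.

HB.instance Definition _ := GRing.Zmodule_isLmodule.Build {poly F} (res_h M)
  res_h_actA res_h_act1 res_h_actDr res_h_actDl.
End Restriction.

End EnvelopingAlgebra.
Arguments MPQ {F} P Q PQ.

Definition free_of_rank (A : nzRingType) (n : nat) (V : lmodType A) : Prop :=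
  exists e : 'I_n -> V,
    forall v : V, exists! c : {ffun 'I_n -> A}, v = \sum_(i < n) c i *: e i.

Definition lmod_iso (A : nzRingType) (V W : lmodType A) : Prop :=
  exists f : {linear V -> W}, bijective f.

(* Main.v *)
Require Import Defs.
From HB Require Import structures.
From mathcomp Require Import all_boot all_order all_algebra reals complex.
From mathcomp Require Import boolp generic_quotient ring.

Import GRing.Theory.
Local Open Scope ring_scope.

(** Let [x] and [y] act on a free [F[h]]-module of rank 2 with [x^2 = y^2 = 0]
and [xy + yx = h]. The kernels of [x] and [y] are saturated of rank 1, hence
generated by vectors [u] and [v]. Then [x v = a u] and [y u = b v] for some
[a, b] in [F[h]], and [h u = xy u = ab u], so that [ab = h] and one of [a], [b]
is a nonzero constant. If it is [a], then [(x v, v)] is a basis and the module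
is [M(E_12, h E_21)]; if it is [b], then [(u, y u)] is a basis and the module
is [M(h E_12, E_21)]. These two differ because [x] maps the second one into its
multiples of [h], but not the first one. *)

(** * Bases of modules that are free of rank 2 *)

Definition is_basis2 {A : nzRingType} {V : lmodType A} (e0 e1 : V) : Prop :=
  (forall v, exists a b, v = a *: e0 + b *: e1) /\
  (forall a b, a *: e0 + b *: e1 = 0 -> a = 0 /\ b = 0).

Lemma is_basis2C {A : nzRingType} {V : lmodType A} (e0 e1 : V) :
  is_basis2 e0 e1 -> is_basis2 e1 e0.
Proof.
move=> [sp ind]; split.
  by move=> v; have [a [b ->]] := sp v; exists b, a; rewrite addrC.
by move=> a b; rewrite addrC => /ind[-> ->].
Qed.

Lemma free_of_rank2_basis {A : nzRingType} {V : lmodType A} :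
  free_of_rank 2 V -> exists e0 e1 : V, is_basis2 e0 e1.
Proof.
move=> [e eP].
have sumE (c : {ffun 'I_2 -> A}) : \sum_(i < 2) c i *: e i = c 0 *: e 0 + c 1 *: e 1.
  rewrite !big_ord_recl big_ord0 addr0.
  by rewrite (_ : lift ord0 ord0 = 1) //; apply: val_inj.
exists (e 0), (e 1); split.
  by move=> v; have [c [-> _]] := eP v; exists (c 0), (c 1); rewrite sumE.
(* The zero family and the family [(a, b)] are both coordinates of [0], so uniqueness identifies
   them. *)
move=> a b ab0; have [c [_ cU]] := eP 0.
have c0 : c = [ffun=> 0].
  by apply: cU; rewrite sumE !ffunE !scale0r addr0.
have cab : c = [ffun i => if i == 0 then a else b].
  by apply: cU; rewrite sumE !ffunE /= ab0.
have /ffunP cE : [ffun i : 'I_2 => if i == 0 then a else b] = [ffun=> 0].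
  by rewrite -cab c0.
by move: (cE 0) (cE 1); rewrite !ffunE.
Qed.

Lemma basis2_torsion_free {A : idomainType} {V : lmodType A} {e0 e1 : V} a (v : V) :
  is_basis2 e0 e1 -> a *: v = 0 -> a != 0 -> v = 0.
Proof.
move=> [sp ind] + a0; have [b [c ->]] := sp v.
rewrite scalerDr !scalerA => /ind[/eqP + /eqP].
by rewrite !mulf_eq0 (negPf a0) /= => /eqP-> /eqP->; rewrite !scale0r addr0.
Qed.

(** * Square-zero endomorphisms of a free [F[h]]-module of rank 2 *)

Section SquareZero.
Variables (F : fieldType) (V : lmodType {poly F}) (e0 e1 : V).
Hypothesis eB : is_basis2 e0 e1.

(** Dividing a nonzero value [f r0] by the gcd [g] of its coordinates gives a primitive vector [u].
    It is killed by [f] because [g u = f r0] is and [V] is torsion free. A Bezout relation completes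
    [u] by some [w], and [f w] is nonzero since [f] is. *)
Lemma ker_square_zero (f : {linear V -> V}) :
    (forall v, f (f v) = 0) -> (exists v, f v != 0) ->
  exists u, [/\ u != 0, f u = 0 & forall v, f v = 0 -> exists a, v = a *: u].
Proof.
move=> ff [r0 fr0]; case: (eB) => sp ind.
have [a [b abE]] := sp (f r0); set g := gcdp a b.
have g0 : g != 0.
  apply: contra fr0; rewrite gcdp_eq0 abE => /andP[/eqP-> /eqP->].
  by rewrite !scale0r addr0.
have ab0 : (a != 0) || (b != 0) by move: g0; rewrite gcdp_eq0 negb_and.
have /Bezout_eq1_coprimepP[[s t] /= st1] := coprimep_div_gcd ab0.
move: st1; set a' := a %/ _; set b' := b %/ _ => st1.
have aE : a = g * a' by rewrite mulrC divpK ?dvdp_gcdl.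
have bE : b = g * b' by rewrite mulrC divpK ?dvdp_gcdr.
(* The determinant of [(u, w)] in [(e0, e1)] is [s * a' + t * b' = 1]; the inverse matrix supplies
   the coefficients in [decomp]. *)
pose u := a' *: e0 + b' *: e1; pose w := - t *: e0 + s *: e1.
have guE : f r0 = g *: u by rewrite abE aE bE scalerDr !scalerA.
have fu : f u = 0.
  by apply: basis2_torsion_free eB _ g0; rewrite -linearZ -guE ff.
have decomp v : exists c d, v = c *: u + d *: w.
  have [c [d ->]] := sp v.
  exists (s * c + t * d), (a' * d - b' * c).
  rewrite !scalerDr !scalerA addrACA -!scalerDl.
  congr (_ *: _ + _ *: _).
    by rewrite -[LHS]mulr1 -st1; ring.
  by rewrite -[LHS]mulr1 -st1; ring.
exists u; split=> //.
  by apply: contraNneq fr0 => u0; rewrite guE u0 scaler0.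
move=> v; have [c [d ->]] := decomp v.
rewrite linearD !linearZ /= fu scaler0 add0r => fw.
(* If [d] is nonzero, then [f] kills [w] as well as [u], contradicting [f r0 != 0]. *)
have [->|d0] := eqVneq d 0; first by exists c; rewrite scale0r addr0.
have fw0 : f w = 0 := basis2_torsion_free _ _ eB fw d0.
have [c' [d' r0E]] := decomp r0.
by case/eqP: fr0; rewrite r0E linearD !linearZ /= fu fw0 !scaler0 addr0.
Qed.

(** Since [a] is a nonzero constant, [f v] generates the kernel of [f], which contains the image;
    thus [f v |-> v] splits [f] onto its image, and [V] is the sum of the kernel and the span of
    [v]. *)
Lemma basis2_of_ker (f : {linear V -> V}) (u v : V) a :
    u != 0 -> f u = 0 -> (forall w, f w = 0 -> exists c, w = c *: u) ->
    (forall w, f (f w) = 0) ->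
    f v = a *: u -> size a = 1 ->
  is_basis2 (f v) v.
Proof.
move=> u0 fu kerf ff fv /eqP/size_poly1P[k k0 aE].
have kK : k^-1%:P * a = 1 by rewrite aE -polyCM mulVf.
have uE : u = k^-1%:P *: f v by rewrite fv scalerA kK scale1r.
have fv0 : f v != 0.
  by apply: contra u0; rewrite uE => /eqP->; rewrite scaler0.
split=> [w|b c].
  have [s sE] := kerf _ (ff w).
  have [|t tE] := kerf (w - (s * k^-1%:P) *: v).
    by rewrite linearB linearZ /= sE {1}uE scalerA subrr.
  exists (t * k^-1%:P), (s * k^-1%:P).
  by rewrite -scalerA -uE -tE subrK.
(* Applying [f] to the relation kills its first term and isolates [c]. *)
move=> bc0; have /(basis2_torsion_free _ _ eB) cP : c *: f v = 0.
  by have := congr1 f bc0; rewrite linearD !linearZ /= ff scaler0 add0r linear0.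
have c0 : c = 0 by apply/eqP; apply: contraNT fv0 => /cP->.
split=> //; move: bc0; rewrite c0 scale0r addr0 => /(basis2_torsion_free _ _ eB) bP.
by apply/eqP; apply: contraNT fv0 => /bP->.
Qed.

(** The two alternatives list the columns of the two pairs [(P, Q)] of the classification, with [f]
    in the role of [x] and [g] in that of [y]. *)
Lemma odd_pair_basis (f g : {linear V -> V}) :
    (forall v, f (f v) = 0) -> (forall v, g (g v) = 0) ->
    (forall v, f (g v) + g (f v) = 'X *: v) ->
  exists u v, is_basis2 u v /\
    ([/\ f u = 0, f v = u, g u = 'X *: v & g v = 0] \/
     [/\ f u = 0, f v = 'X *: u, g u = v & g v = 0]).
Proof.
move=> ff gg fg.
have e0N : e0 != 0.
  apply/eqP => e00; have [_ /(_ 1 0)[]] := eB.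
    by rewrite e00 scaler0 scale0r addr0.
  by move/eqP; rewrite oner_eq0.
have XT (v : V) : 'X *: v = 0 -> v = 0.
  by move/(basis2_torsion_free _ _ eB); apply; rewrite polyX_eq0.
(* If [f] were zero, then ['X] would kill [e0]; the same holds for [g] below. *)
have fN : exists v, f v != 0.
  apply: contrapT => /forallNP nf; case/eqP: e0N; apply: XT.
  have f0 v : f v = 0 by apply/eqP/negbNE/negP/nf.
  by rewrite -fg !f0 linear0 addr0.
have gN : exists v, g v != 0.
  apply: contrapT => /forallNP ng; case/eqP: e0N; apply: XT.
  have g0 v : g v = 0 by apply/eqP/negbNE/negP/ng.
  by rewrite -fg !g0 linear0 addr0.
have [u [u0 fu kerf]] := ker_square_zero f ff fN.
have [v [v0 gv kerg]] := ker_square_zero g gg gN.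
have [a aE] := kerf _ (ff v).
have [b bE] := kerg _ (gg u).
have abX : a * b = 'X.
  apply/eqP; rewrite -subr_eq0; apply: contraNT u0 => ab0; apply/eqP.
  apply: basis2_torsion_free eB _ ab0.
  by rewrite scalerBl -fg fu linear0 addr0 bE linearZ /= aE scalerA mulrC subrr.
have [a0 b0] : a != 0 /\ b != 0.
  by apply/andP; rewrite -negb_or -mulf_eq0 abX polyX_eq0.
(* As [size] is the degree plus one, [a * b = 'X] forces the two positive sizes to add up to 3. *)
have [sa|sb] : size a = 1%N \/ size b = 1%N.
  move: (size_mul a0 b0); rewrite abX size_polyX.
  move: a0 b0; rewrite -!size_poly_gt0.
  case: (size a) (size b) => [|[|m]] [|[|n]] //= _ _.
  - by left.
  - by right.
  - by rewrite !addSn !addnS.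
- have B := basis2_of_ker f u v a u0 fu kerf ff aE sa.
  exists (f v), v; split=> //; left; split=> //.
  by rewrite -fg gv linear0 add0r.
(* With [f] and [g] exchanged the basis comes out as [(g u, u)], hence the swap. *)
- have B := basis2_of_ker g v u b v0 gv kerg gg bE sb.
  exists u, (g u); split; first exact: is_basis2C.
  by right; split=> //; rewrite -fg fu linear0 addr0.
Qed.

End SquareZero.

(** * Generators and relations of the enveloping algebra *)

Section Relations.
Variable F : fieldType.

Lemma Ugen_xyh (a : sl11 F) :
  Ugen a = val a 0 1 *: Ux F + val a 1 0 *: Uy F + val a 0 0 *: Uh F.
Proof.
have G0 : Ugen (0 : sl11 F) = 0.
  have := Ugen_linear (-1) (0 : sl11 F) 0.
  by rewrite scaler0 addr0 scaleN1r addNr.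
(* The final [+ 0] gives the last term the shape [k *: a + b] of [Ugen_linear]. *)
have -> : a = val a 0 1 *: sl_x F + (val a 1 0 *: sl_y F + (val a 0 0 *: sl_h F + 0)).
  apply: val_inj; apply: mx22P; rewrite /= !mxE /= ?mulr0 ?mulr1 ?addr0 ?add0r //.
  by apply/eqP; rewrite eq_sym -subr_eq0; exact: (valP a).
rewrite !Ugen_linear G0 addr0 addrA.
by rewrite /= !mxE /= !(mulr0, mulr1, addr0, add0r).
Qed.

(** Induction on a representing term; it reduces compatibility with the whole algebra to scalars and
    the three generators. *)
Lemma Usl11_ind (K : Usl11 F -> Prop) :
    (forall k, K k%:A) -> K (Ux F) -> K (Uy F) -> K (Uh F) ->
    (forall a b, K a -> K b -> K (a + b)) ->
    (forall a b, K a -> K b -> K (a * b)) ->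
  forall a, K a.
Proof.
move=> KA Kx Ky Kh KD KM a.
have KZ k b : K b -> K (k *: b) by move=> Kb; rewrite -mulr_algl; apply: KM.
elim/quotW: a; elim.
- move=> a; suff: K (Ugen a) by [].
  rewrite Ugen_xyh.
  by apply: (KD); [apply: KD|]; apply: KZ.
- by have := KA 0; rewrite scale0r.
- by have := KA 1; rewrite scale1r.
- by move=> t /(KZ (-1)); rewrite scaleN1r -pi_Uopp.
- by move=> t Kt u Ku; rewrite -pi_Uadd; apply: KD.
- by move=> t Kt u Ku; rewrite -pi_Umul; apply: KM.
- by move=> k t Kt; rewrite -pi_Uscale; apply: KZ.
Qed.

Lemma homogeneous_x : homogeneous true (sl_x F).
Proof. by move=> i j; rewrite /= mxE; case: (i) (j) => [[|[|?]] ?] [[|[|?]] ?]. Qed.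

Lemma homogeneous_y : homogeneous true (sl_y F).
Proof. by move=> i j; rewrite /= mxE; case: (i) (j) => [[|[|?]] ?] [[|[|?]] ?]. Qed.

Lemma homogeneous_h : homogeneous false (sl_h F).
Proof. by move=> i j; rewrite /= mxE; case: (i) (j) => [[|[|?]] ?] [[|[|?]] ?]. Qed.

Lemma Uxy : Ux F * Uy F + Uy F * Ux F = Uh F.
Proof.
have := Ugen_bracket homogeneous_x homogeneous_y.
rewrite expr1 scaleN1r opprK => <-; congr Ugen.
apply: val_inj; rewrite /= mx_superbracketE.
by apply: mx22P; rewrite !mxE /=; ring.
Qed.

Lemma Uhx : Uh F * Ux F = Ux F * Uh F.
Proof.
have := Ugen_bracket homogeneous_h homogeneous_x.
rewrite expr0 scale1r.
rewrite [superbracket _ _](_ : _ = 0).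
  by rewrite Ugen_xyh !mxE !scale0r !addr0 => /esym/eqP; rewrite subr_eq0 => /eqP.
apply: val_inj; rewrite /= mx_superbracketE.
by apply: mx22P; rewrite !mxE /=; ring.
Qed.

Lemma Uhy : Uh F * Uy F = Uy F * Uh F.
Proof.
have := Ugen_bracket homogeneous_h homogeneous_y.
rewrite expr0 scale1r.
rewrite [superbracket _ _](_ : _ = 0).
  by rewrite Ugen_xyh !mxE !scale0r !addr0 => /esym/eqP; rewrite subr_eq0 => /eqP.
apply: val_inj; rewrite /= mx_superbracketE.
by apply: mx22P; rewrite !mxE /=; ring.
Qed.

Hypothesis two_neq0 : 2%:R != 0 :> F.

(** For odd [a] the bracket relation reads [[a, a] = 2 a^2], and 2 is invertible. *)
Lemma Uodd_sq0 (a : sl11 F) :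
  homogeneous true a -> superbracket a a = 0 -> Ugen a * Ugen a = 0.
Proof.
move=> ha aa; have := Ugen_bracket ha ha.
rewrite aa expr1 scaleN1r opprK Ugen_xyh !mxE !scale0r !addr0 => /esym/eqP.
rewrite -mulr2n -scaler_nat => /eqP /(congr1 ( *:%R 2%:R^-1)).
by rewrite scaler0 scalerA mulVf // scale1r.
Qed.

Lemma Uxx : Ux F * Ux F = 0.
Proof.
apply: Uodd_sq0 homogeneous_x _; apply: val_inj; rewrite /= mx_superbracketE.
by apply: mx22P; rewrite !mxE /=; ring.
Qed.

Lemma Uyy : Uy F * Uy F = 0.
Proof.
apply: Uodd_sq0 homogeneous_y _; apply: val_inj; rewrite /= mx_superbracketE.
by apply: mx22P; rewrite !mxE /=; ring.
Qed.

End Relations.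

(** With [a] the element [h], this makes [x] and [y] commute with every [p(h)], so that they act
    [F[h]]-linearly. *)
Lemma comm_horner_alg {F : comNzRingType} {A : algType F} (a b : A) p :
  a * b = b * a -> horner_alg a p * b = b * horner_alg a p.
Proof.
move=> ab; elim/poly_ind: p => [|p c IH]; first by rewrite rmorph0 mul0r mulr0.
rewrite rmorphD rmorphM /= horner_algX horner_algC mulrDl mulrDr.
by rewrite -mulrA ab mulrA IH mulrA mulr_algl mulr_algr.
Qed.

(** * The odd action over [F[h]], and recognition of [M(P, Q)] from a basis *)

Section OddAction.
Context {F : fieldType} {M : lmodType (Usl11 F)}.

Definition res_x (v : res_h M) : res_h M := Ux F *: (v : M).
Definition res_y (v : res_h M) : res_h M := Uy F *: (v : M).

Lemma res_hE p (v : res_h M) : p *: v = horner_alg (Uh F) p *: (v : M) :> M.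
Proof. by []. Qed.

Lemma res_h_X (v : res_h M) : 'X *: v = Uh F *: (v : M).
Proof. by rewrite res_hE horner_algX. Qed.

Lemma res_h_C k (v : res_h M) : k%:P *: v = (k%:A : Usl11 F) *: (v : M).
Proof. by rewrite res_hE horner_algC. Qed.

Lemma res_x_linear : linear res_x.
Proof.
move=> p u v; rewrite /res_x !res_hE scalerDr !scalerA.
by rewrite comm_horner_alg //; exact: Uhx.
Qed.
HB.instance Definition _ :=
  GRing.isLinear.Build {poly F} (res_h M) (res_h M) *:%R res_x res_x_linear.

Lemma res_y_linear : linear res_y.
Proof.
move=> p u v; rewrite /res_y !res_hE scalerDr !scalerA.
by rewrite comm_horner_alg //; exact: Uhy.
Qed.
HB.instance Definition _ :=
  GRing.isLinear.Build {poly F} (res_h M) (res_h M) *:%R res_y res_y_linear.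

(** The columns of [P] and [Q] are the coordinates of the images of [u] and [v]. Hence the
    coordinate map [g] commutes with the generators, and so with the whole algebra. *)
Lemma lmod_iso_MPQ P Q (PQ : MPQ_rel P Q) (u v : res_h M) :
    is_basis2 u v ->
    res_x u = P 0 0 *: u + P 1 0 *: v -> res_x v = P 0 1 *: u + P 1 1 *: v ->
    res_y u = Q 0 0 *: u + Q 1 0 *: v -> res_y v = Q 0 1 *: u + Q 1 1 *: v ->
  lmod_iso M (MPQ P Q PQ).
Proof.
move=> [sp ind] xu xv yu yv.
pose g (c : MPQ P Q PQ) : res_h M := c 0 0 *: u + c 1 0 *: v.
have gD c d : g (c + d) = g c + g d.
  by rewrite /g !mxE !scalerDl addrACA.
have gN c : g (- c) = - g c by rewrite /g !mxE !scaleNr opprD.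
have gZ p (c : 'cV_2) : g (p *: c) = p *: g c.
  by rewrite /g !mxE scalerDr !scalerA.
have g_act a c : g (a *: c) = a *: (g c : M).
  elim/Usl11_ind: a c => [k|||| a b IHa IHb|a b IHa IHb] c.
  - rewrite -res_h_C -gZ; congr g.
    (* [k%:A] is by definition the class of this term, whose evaluation is [k%:P] times that of a
       representative of 1. *)
    rewrite [LHS](MPQ_act_pi (Uscale_t k (repr (1 : Usl11 F)))) /=.
    by rewrite -scalemxAl -[in RHS](scale1r c).
  - rewrite MPQ_x -[RHS]/(res_x (g c)) /g linearD !linearZ /= xu xv.
    by rewrite !mulmx2E !scalerDr !scalerA addrACA -!scalerDl ![c _ _ * _]mulrC.
  - rewrite MPQ_y -[RHS]/(res_y (g c)) /g linearD !linearZ /= yu yv.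
    by rewrite !mulmx2E !scalerDr !scalerA addrACA -!scalerDl ![c _ _ * _]mulrC.
  - by rewrite MPQ_h gZ res_h_X.
  - by rewrite !scalerDl gD IHa IHb.
  - by rewrite -!scalerA IHa IHb.
have g_inj : injective g.
  move=> c d cd; apply/eqP; rewrite -subr_eq0; apply/eqP.
  have /ind[c0 c1] : g (c - d) = 0 by rewrite gD gN cd subrr.
  apply/matrixP => i j; rewrite ord1 [RHS]mxE.
  have [->|->] // : i = 0 \/ i = 1.
  by case: i => [[|[|//]] ?]; [left | right]; apply: val_inj.
(* A right inverse of [g] is chosen from surjectivity; injectivity of [g] then gives its
   linearity. *)
have /boolp.choice[f fK] : forall w : M, exists c : MPQ P Q PQ, g c = w.
  move=> w; have [a [b wE]] := sp w.
  exists (\col_i if i == 0 then a else b).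
  by rewrite /g !mxE /= wE.
have f_lin : linear f by move=> a w z; apply: g_inj; rewrite gD g_act !fK.
pose f' : {linear M -> MPQ P Q PQ} :=
  HB.pack f (GRing.isLinear.Build (Usl11 F) M (MPQ P Q PQ) *:%R f f_lin).
exists f'; exists g => // c.
by apply: g_inj; rewrite fK.
Qed.

End OddAction.

(** * Separation of the two modules by the image of [x] *)

Lemma MPQ_1h_h1_not_iso (F : fieldType) :
  ~ lmod_iso (MPQ (mx22 0 1 0 0) (mx22 0 0 'X 0) (MPQ_rel_1h F))
             (MPQ (mx22 0 'X 0 0) (mx22 0 0 1 0) (MPQ_rel_h1 F)).
Proof.
move=> [f [g fK gK]].
pose e0 : MPQ _ _ (MPQ_rel_1h F) := \col_i if i == 0 then 1 else 0.
pose e1 : MPQ _ _ (MPQ_rel_1h F) := \col_i if i == 0 then 0 else 1.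
have xe1 : Ux F *: e1 = e0.
  rewrite MPQ_x; apply/matrixP => i j; rewrite ord1 mulmx2E !mxE /=.
  by case: (i == 0); ring.
(* In the target, [x] sends a column [(p, q)] to [(h q, 0)]; dividing [x f(e1)] by [h] yields
   [w]. *)
pose w : MPQ _ _ (MPQ_rel_h1 F) := \col_i if i == 0 then f e1 1 0 else 0.
have fe0 : f e0 = Uh F *: w.
  rewrite -xe1 linearZ /= MPQ_x MPQ_h.
  apply/matrixP => i j; rewrite ord1 mulmx2E !mxE /=.
  by case: (i == 0); ring.
have : e0 = Uh F *: g w by apply: (can_inj fK); rewrite linearZ /= gK.
rewrite MPQ_h => /matrixP/(_ 0 0); rewrite !mxE /=.
(* The top entry of [e0] is 1, but that of a multiple of ['X] vanishes at 0. *)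
move/(congr1 (horner_eval 0)); rewrite /horner_eval !hornerE.
by move/eqP; rewrite oner_eq0.
Qed.

Theorem theorem3p2 (R : realType) :
  (forall M : lmodType (Usl11 R[i]), free_of_rank 2 (res_h M) ->
     lmod_iso M (MPQ (mx22 0 1 0 0) (mx22 0 0 'X 0) (MPQ_rel_1h R[i])) \/
     lmod_iso M (MPQ (mx22 0 'X 0 0) (mx22 0 0 1 0) (MPQ_rel_h1 R[i]))) /\
  ~ lmod_iso (MPQ (mx22 0 1 0 0) (mx22 0 0 'X 0) (MPQ_rel_1h R[i]))
             (MPQ (mx22 0 'X 0 0) (mx22 0 0 1 0) (MPQ_rel_h1 R[i])).
Proof.
split; last exact: MPQ_1h_h1_not_iso.
have two_neq0 : 2%:R != 0 :> R[i] by rewrite Num.Theory.pnatr_eq0.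
move=> M /free_of_rank2_basis[e0 [e1 eB]].
have xx (v : res_h M) : res_x (res_x v) = 0.
  by rewrite /res_x scalerA Uxx // scale0r.
have yy (v : res_h M) : res_y (res_y v) = 0.
  by rewrite /res_y scalerA Uyy // scale0r.
have xy (v : res_h M) : res_x (res_y v) + res_y (res_x v) = 'X *: v.
  by rewrite res_h_X -Uxy scalerDl -!scalerA.
have [u [v [uvB [[xu xv yu yv]|[xu xv yu yv]]]]] := odd_pair_basis _ _ _ _ eB res_x res_y xx yy xy.
  left; apply: lmod_iso_MPQ uvB _ _ _ _;
    by rewrite !mxE /= ?scale0r ?scale1r ?addr0 ?add0r.
right; apply: lmod_iso_MPQ uvB _ _ _ _;
  by rewrite !mxE /= ?scale0r ?scale1r ?addr0 ?add0r.
Qed.
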